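(* Let $F\subset\mathbb{R}^d$ be a compact convex set with $0\in\operatorname{int}(F)$, let $m\ge 2$, $1\le k\le m$, $I=\{1,\dots,m\}$, $J_k=\{1,\dots,k\}$, and let $\Omega^1,\dots,\Omega^m\subset\mathbb{R}^d$ be nonempty compact sets. Let $\overline{x}=(\overline{x}^1,\dots,\overline{x}^k)\in\mathbb{R}^{dk}$ and suppose that $J_i(\overline{x})$ is a singleton for every $i\in I$. Consider the following assertions: (a) For each $j\in J_k$, if $A_{\overline{x}^j}$ is nonempty, then $\overline{x}^j$ is a global minimizer over $\mathbb{R}^d$ of the function $x\mapsto\sum_{i\in I(\overline{x}^j)}T_F(x,\Omega^i)$. (b) $\overline{x}$ is a local optimal solution of the problem of minimizing $f_k$ over $\mathbb{R}^{dk}$. Then (a) implies (b). The converse implication (b) $\Rightarrow$ (a) also holds if, in addition, $\Omega^i$ is convex for every $i\in I$.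
   Context: $\mathbb{R}^d$ ($d\ge1$) and $\mathbb{R}^{dk}=(\mathbb{R}^d)^k$ carry their Euclidean norms; $\mathbb{B}(a;r)$ is the open ball. For a nonempty set $\Omega\subset\mathbb{R}^d$ the minimal time function is $T_F(x,\Omega)=\inf\{t\ge 0\mid (x+tF)\cap\Omega\neq\emptyset\}$. The objective is $f_k(x)=\sum_{i\in I}\min_{j\in J_k}T_F(x^j,\Omega^i)$ for $x=(x^1,\dots,x^k)\in\mathbb{R}^{dk}$. For $x\in\mathbb{R}^{dk}$ and $j\in J_k$ (all depending on the whole vector $x$): $A_{x^j}=\{\Omega^i\mid i\in I,\ T_F(x^j,\Omega^i)=\min_{r\in J_k}T_F(x^r,\Omega^i)\}$, $I(x^j)=\{i\in I\mid\Omega^i\in A_{x^j}\}$, and for $i\in I$, $J_i(x)=\{j\in J_k\mid\Omega^i\in A_{x^j}\}$. A point $\overline{x}\in\mathbb{R}^{dk}$ is a local optimal solution if there is $\varepsilon>0$ with $f_k(\overline{x})\le f_k(x)$ for all $x\in\mathbb{B}(\overline{x};\varepsilon)$. *)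

(* Defs.v *)
From HB Require Import structures.
From mathcomp Require Import all_boot all_order all_algebra.
From mathcomp Require Import all_classical all_reals all_analysis.

Set Implicit Arguments.
Unset Strict Implicit.
Unset Printing Implicit Defensive.

Import Order.TTheory GRing.Theory Num.Theory.
Import numFieldNormedType.Exports.

Local Open Scope classical_set_scope.
Local Open Scope ring_scope.

(* A point x = (x^1, ..., x^k) of (R^d)^k is a matrix with k rows, x^j being
   row j x.  The library norm on matrices is the sup norm; it induces the same
   topology as the Euclidean norm below. *)
Definition euclid_norm (R : realType) (p q : nat) (x : 'M[R]_(p, q)) : R :=
  Num.sqrt (\sum_(i < p) \sum_(j < q) x i j ^+ 2).

Definition euclid_ball (R : realType) (p q : nat) (a : 'M[R]_(p, q)) (r : R) :
    set 'M[R]_(p, q) :=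
  [set x | euclid_norm (x - a) < r].

(* The infimum is over a nonempty set as soon as 0 is interior to F and O is
   nonempty, so the real-valued inf takes no default value there. *)
Definition minimal_time (R : realType) (d : nat) (F : set 'rV[R]_d)
    (x : 'rV[R]_d) (O : set 'rV[R]_d) : R :=
  inf [set t : R | 0 <= t /\ [set x + t *: v | v in F] `&` O !=set0].

(* min_{r in J} T_F(x^r, O) over the k.+1 rows of x; the initial value of the
   iterated minimum is itself one of the terms. *)
Definition min_time (R : realType) (d k : nat) (F : set 'rV[R]_d)
    (x : 'M[R]_(k.+1, d)) (O : set 'rV[R]_d) : R :=
  \big[Num.min/minimal_time F (row ord0 x) O]_(r < k.+1)
    minimal_time F (row r x) O.

Definition objective (R : realType) (d k m : nat) (F : set 'rV[R]_d)
    (Om : 'I_m -> set 'rV[R]_d) (x : 'M[R]_(k.+1, d)) : R :=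
  \sum_(i < m) min_time F x (Om i).

(* A_{x^j}: a collection of sets, in which coinciding targets are identified. *)
Definition center_cluster (R : realType) (d k m : nat) (F : set 'rV[R]_d)
    (Om : 'I_m -> set 'rV[R]_d) (x : 'M[R]_(k.+1, d)) (j : 'I_k.+1) :
    set (set 'rV[R]_d) :=
  [set Om i | i in
    [set i | minimal_time F (row j x) (Om i) = min_time F x (Om i)]].

(* I(x^j) *)
Definition cluster_index (R : realType) (d k m : nat) (F : set 'rV[R]_d)
    (Om : 'I_m -> set 'rV[R]_d) (x : 'M[R]_(k.+1, d)) (j : 'I_k.+1) :
    set 'I_m :=
  [set i | center_cluster F Om x j (Om i)].

(* J_i(x) *)
Definition nearest_centers (R : realType) (d k m : nat) (F : set 'rV[R]_d)
    (Om : 'I_m -> set 'rV[R]_d) (x : 'M[R]_(k.+1, d)) (i : 'I_m) :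
    set 'I_k.+1 :=
  [set j | center_cluster F Om x j (Om i)].

Definition local_optimal (R : realType) (p q : nat) (f : 'M[R]_(p, q) -> R)
    (a : 'M[R]_(p, q)) : Prop :=
  exists2 eps : R, 0 < eps & forall x, euclid_ball a eps x -> f a <= f x.

Definition global_minimizer (R : realType) (T : Type) (f : T -> R) (a : T) :
    Prop :=
  forall x, f a <= f x.

(* Main.v *)
Require Import Defs.
From HB Require Import structures.
From mathcomp Require Import all_boot all_order all_algebra.
From mathcomp Require Import all_classical all_reals all_analysis.
From mathcomp Require Import lra.

(* Since each target has a strictly closest center c i at xbar and T_F(., O) is
   Lipschitz (F contains a ball around 0), c i stays the closest center of
   Om i near xbar.  So locally the objective is
   \sum_j \sum_(i | c i = j) T_F(x^j, Om i), a sum of functions of independent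
   blocks x^j, minimized locally iff every block is.  For convex targets the
   inner sums are convex, hence their local minimizers are global. *)

Import Order.TTheory GRing.Theory Num.Theory.
Import numFieldNormedType.Exports.

Set Implicit Arguments.
Unset Strict Implicit.
Unset Printing Implicit Defensive.

Local Open Scope classical_set_scope.
Local Open Scope ring_scope.

(** * Euclidean norm and finite minima *)

Lemma euclid_norm_ge0 (R : realType) (p q : nat) (x : 'M[R]_(p, q)) :
  0 <= euclid_norm x.
Proof. exact: sqrtr_ge0. Qed.

Lemma euclid_normZ (R : realType) (p q : nat) (t : R) (x : 'M[R]_(p, q)) :
  0 <= t -> euclid_norm (t *: x) = t * euclid_norm x.
Proof.
move=> t0; rewrite /euclid_norm -[t in RHS]ger0_norm// -sqrtr_sqr.
rewrite -sqrtrM ?sqr_ge0// mulr_sumr; congr Num.sqrt.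
by apply: eq_bigr => i _; rewrite mulr_sumr; apply: eq_bigr => j _;
  rewrite mxE exprMn.
Qed.

Lemma coord_le_euclid_norm (R : realType) (p q : nat) (x : 'M[R]_(p, q)) i j :
  `|x i j| <= euclid_norm x.
Proof.
rewrite -sqrtr_sqr ler_wsqrtr// (bigD1 i)//= (bigD1 j)//= -addrA lerDl.
by apply: addr_ge0; apply: sumr_ge0 => r _; [|apply: sumr_ge0 => s _];
  rewrite sqr_ge0.
Qed.

(** Links the sup norm on rows, in which the Lipschitz bounds are stated, to the Euclidean balls of
    local optimality. *)
Lemma norm_row_le_euclid_norm (R : realType) (p q : nat)
    (x : 'M[R]_(p, q.+1)) i : `|row i x| <= euclid_norm x.
Proof.
rewrite /Num.norm/= mx_normrE; apply: bigmax_le => [|j _].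
  exact: euclid_norm_ge0.
by rewrite mxE coord_le_euclid_norm.
Qed.

(** The finite minimum starts at 1, so it is positive even when no index satisfies [P]. *)
Lemma positive_lower_bound (R : realType) (I : finType) (P : pred I)
    (g : I -> R) : (forall i, P i -> 0 < g i) ->
  exists2 e : R, 0 < e & forall i, P i -> e <= g i.
Proof.
move=> g0; exists (\big[Num.min/1]_(i | P i) g i).
  by apply: lt_bigmin.
by move=> i Pi; exact: bigmin_le_cond.
Qed.

(** * Nonnegative combinations in a convex set *)

Section convex_cone.
Context (R : realType) (V : lmodType R) (A : set V).
Hypothesis A_convex : convex_set A.

Lemma convex_comb (l : R) (x y : V) : 0 <= l -> l <= 1 -> A x -> A y ->
  A (l *: x + (1 - l) *: y).
Proof.
move=> l0 l1 /mem_set Ax /mem_set Ay.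
by have := @A_convex x y (Itv01 l0 l1) Ax Ay; rewrite inE.
Qed.

(** Dividing by [s + t] gives a convex combination. This merges two successive displacements along
    [F] into one whose time is the sum of both. *)
Lemma convex_cone_add (s t : R) (u v : V) : 0 <= s -> 0 <= t -> A u -> A v ->
  exists2 w, A w & s *: u + t *: v = (s + t) *: w.
Proof.
move=> s0 t0 Au Av; have [st0|st0] := eqVneq (s + t) 0.
  have [-> ->] : s = 0 /\ t = 0 by split; lra.
  by exists u; rewrite // addr0 !scale0r addr0.
have st : 0 < s + t by rewrite lt_neqAle eq_sym st0 addr_ge0.
exists (s / (s + t) *: u + (1 - s / (s + t)) *: v).
  apply: convex_comb => //; first by rewrite divr_ge0// ltW.
  by rewrite ler_pdivrMr// mul1r lerDl.
rewrite scalerDr !scalerA mulrBr mulr1 mulrC divfK//.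
by rewrite addrAC subrr add0r.
Qed.

End convex_cone.

(** * Lipschitz continuity and convexity of the minimal time function *)

Section minimal_time.
Context (R : realType) (d : nat) (F : set 'rV[R]_d.+1).
Hypothesis F_convex : convex_set F.
Hypothesis F_int0 : F° 0.

(** If the ball of radius [e] around 0 lies in [F], every nonzero [z] rescaled to norm [e / 2] is in
    [F]; hence [L = 2 / e]. *)
Lemma gauge_bound : exists2 L : R, 0 < L &
  forall z : 'rV[R]_d.+1, exists2 v, F v & z = (L * `|z|) *: v.
Proof.
have /nbhs_ballP[e /= e0 eF] := F_int0.
exists (2 / e); first by rewrite divr_gt0.
move=> z; have [->|z0] := eqVneq z 0.
  exists 0; first by apply: eF; exact: ballxx.
  by rewrite scaler0.
have z_gt0 : 0 < `|z| by rewrite normr_gt0.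
have L0 : 0 < 2 / e * `|z| by rewrite mulr_gt0// divr_gt0.
exists ((2 / e * `|z|)^-1 *: z); last first.
  by rewrite scalerA divff ?scale1r// gt_eqF.
apply: eF; rewrite -ball_normE /ball_/= sub0r normrN normrZ.
rewrite gtr0_norm ?invr_gt0// invfM mulrC mulrA mulrAC divff ?gt_eqF// mul1r.
by rewrite invf_div; lra.
Qed.

Implicit Types (x y : 'rV[R]_d.+1) (O : set 'rV[R]_d.+1).

Lemma minimal_time_le x O (t : R) (v o : 'rV[R]_d.+1) :
  0 <= t -> F v -> O o -> x + t *: v = o -> minimal_time F x O <= t.
Proof.
move=> t0 Fv Oo xo; apply: ge_inf; first by exists 0 => s [].
by split => //; exists o; split => //; exists v.
Qed.

(** By [gauge_bound] any point of [O] is reached in finite time, so the infimum is over a nonempty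
    set bounded below by 0. *)
Lemma minimal_time_adherent x O (e : R) : O !=set0 -> 0 < e ->
  exists t : R, exists v o, [/\ 0 <= t, F v, O o, x + t *: v = o &
    t < minimal_time F x O + e].
Proof.
move=> [p Op] e0; rewrite /minimal_time; set E := (X in inf X).
have hE : has_inf E.
  split; last by exists 0 => s [].
  have [L L0 /(_ (p - x))[v Fv pxv]] := gauge_bound.
  exists (L * `|p - x|); split; first by rewrite mulr_ge0// ltW.
  by exists p; split => //; exists v => //; rewrite -pxv addrC subrK.
have [t [t0 [q [[v Fv xq] Oq]]] tE] := inf_adherent e0 hE.
by exists t, v, q.
Qed.

(** Travel from [x] to [y] in time [L * |y - x|], then almost optimally from [y] to [O];
    [convex_cone_add] makes this a single trip. *)
Lemma minimal_time_lipschitz : exists2 L : R, 0 < L &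
  forall x y O, O !=set0 ->
    minimal_time F x O <= minimal_time F y O + L * `|y - x|.
Proof.
have [L L0 HL] := gauge_bound; exists L => // x y O O0.
apply/ler_addgt0Pr => e e0.
have [t [v [z [t0 Fv Oz yz tT]]]] := minimal_time_adherent y O0 e0.
have [u Fu yx] := HL (y - x).
have s0 : 0 <= L * `|y - x| by rewrite mulr_ge0// ltW.
have [w Fw uvw] := convex_cone_add F_convex s0 t0 Fu Fv.
apply: (@le_trans _ _ (L * `|y - x| + t)); last by lra.
apply: (@minimal_time_le _ _ _ w z) => //; first exact: addr_ge0.
by rewrite -uvw -yx addrA subrKC.
Qed.

Lemma minimal_time_convex x y O (l : R) : O !=set0 -> convex_set O ->
  0 <= l -> l <= 1 ->
  minimal_time F (l *: x + (1 - l) *: y) O <=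
  l * minimal_time F x O + (1 - l) * minimal_time F y O.
Proof.
move=> O0 O_convex l0 l1; apply/ler_addgt0Pr => e e0.
have [t [v [p [t0 Fv Op xp tT]]]] := minimal_time_adherent x O0 e0.
have [s [u [q [s0 Fu Oq yq sT]]]] := minimal_time_adherent y O0 e0.
have l10 : 0 <= 1 - l by rewrite subr_ge0.
(* The weighted average of two almost optimal trips is again a trip along [F], and it ends in [O] by
   convexity. *)
have [w Fw vuw] := convex_cone_add F_convex
  (mulr_ge0 l0 t0) (mulr_ge0 l10 s0) Fv Fu.
apply: (@le_trans _ _ (l * t + (1 - l) * s)); last by nra.
apply: (@minimal_time_le _ _ _ w (l *: p + (1 - l) *: q)) => //.
- by rewrite addr_ge0// mulr_ge0.
- exact: convex_comb.
- by rewrite -vuw -xp -yq !scalerDr !scalerA addrACA.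
Qed.

End minimal_time.

(** * Clusters and their stability near [xbar] *)

Section clusters.
Context (R : realType) (d k m : nat) (F : set 'rV[R]_d.+1).
Context (Om : 'I_m -> set 'rV[R]_d.+1).
Implicit Types (x : 'M[R]_(k.+1, d.+1)).

Lemma min_time_le x O r : min_time F x O <= minimal_time F (row r x) O.
Proof. exact: bigmin_le. Qed.

Lemma min_time_eq x O c :
  (forall r, minimal_time F (row c x) O <= minimal_time F (row r x) O) ->
  min_time F x O = minimal_time F (row c x) O.
Proof.
by move=> cr; apply/eqP; rewrite eq_le min_time_le; exact: le_bigmin.
Qed.

(** Identifying coinciding targets is harmless: the equation depends on [i] only through [Om i]. *)
Lemma nearest_centersE x i j : nearest_centers F Om x i j <->
  minimal_time F (row j x) (Om i) = min_time F x (Om i).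
Proof. by split => [[i' + <-]|?]; last exists i. Qed.

Lemma cluster_sumE x (c : 'I_m -> 'I_k.+1) j y :
  (forall i, nearest_centers F Om x i = [set c i]) ->
  \sum_(i in cluster_index F Om x j) minimal_time F y (Om i) =
  \sum_(i < m | c i == j) minimal_time F y (Om i).
Proof.
move=> cE; apply: eq_bigl => i; apply/idP/idP => [/set_mem ij|/eqP cij].
  have : nearest_centers F Om x i j by [].
  by rewrite cE => /= ->.
have ij : nearest_centers F Om x i j by rewrite cE.
exact: mem_set ij.
Qed.

Lemma objective_partition x (c : 'I_m -> 'I_k.+1) :
  (forall i, min_time F x (Om i) = minimal_time F (row (c i) x) (Om i)) ->
  objective F Om x =
  \sum_(j < k.+1) \sum_(i < m | c i == j) minimal_time F (row j x) (Om i).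
Proof.
move=> cE; rewrite /objective (partition_big c xpredT)//=.
by apply: eq_bigr => j _; apply: eq_bigr => i /eqP <-.
Qed.

Hypothesis F_convex : convex_set F.
Hypothesis F_int0 : F° 0.
Hypothesis Om_neq0 : forall i, Om i !=set0.

(** Let [g] bound from below all gaps between a nearest and a non-nearest center. Within distance
    [g / (2 * L)] each minimal time changes by less than [g / 2], so no other center overtakes
    [c i]. *)
Lemma assignment_locally_constant x0 (c : 'I_m -> 'I_k.+1) :
  (forall i, nearest_centers F Om x0 i = [set c i]) ->
  exists2 e : R, 0 < e & forall x, euclid_ball x0 e x ->
    forall i, min_time F x (Om i) = minimal_time F (row (c i) x) (Om i).
Proof.
move=> cE; pose T x i r := minimal_time F (row r x) (Om i).
have Tc i : T x0 i (c i) = min_time F x0 (Om i).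
  by apply/nearest_centersE; rewrite cE.
have gap i r : r != c i -> 0 < T x0 i r - T x0 i (c i).
  move=> rc; rewrite subr_gt0 lt_neqAle Tc min_time_le andbT.
  apply/negP => /eqP/esym/nearest_centersE; rewrite cE/= => rci.
  by rewrite rci eqxx in rc.
have [g g0 gE] := @positive_lower_bound R ('I_m * 'I_k.+1)%type
  (fun p => p.2 != c p.1) (fun p => T x0 p.1 p.2 - T x0 p.1 (c p.1))
  (fun p => gap p.1 p.2).
have [L L0 HL] := minimal_time_lipschitz F_convex F_int0.
exists (g / (2 * L)); first by rewrite divr_gt0// mulr_gt0.
move=> x; rewrite /euclid_ball/= ltr_pdivlMr ?mulr_gt0// => xg i.
apply: min_time_eq => r; have [->//|rc] := eqVneq r (c i).
have rowB s : `|row s x - row s x0| <= euclid_norm (x - x0).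
  by rewrite -raddfB; exact: norm_row_le_euclid_norm.
have Lrow s : L * `|row s x - row s x0| <= L * euclid_norm (x - x0).
  by rewrite ler_pM2l.
have := HL (row (c i) x) (row (c i) x0) _ (Om_neq0 i).
have := HL (row r x0) (row r x) _ (Om_neq0 i).
have := gE (i, r) rc; rewrite /T/=.
have := Lrow r; have := Lrow (c i); rewrite (distrC (row (c i) x)).
by lra.
Qed.

End clusters.

(** * Local optimality and optimality of each block *)

Theorem theorem4p12 (R : realType) (d k m : nat)
  (F : set 'rV[R]_d.+1) (Om : 'I_m -> set 'rV[R]_d.+1)
  (xbar : 'M[R]_(k.+1, d.+1))
  (F_compact : compact F) (F_convex : convex_set F) (F_int0 : F° 0)
  (m_ge2 : (2 <= m)%N) (k_le_m : (k.+1 <= m)%N)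
  (Om_neq0 : forall i, Om i !=set0) (Om_compact : forall i, compact (Om i))
  (J_singleton : forall i, exists j, nearest_centers F Om xbar i = [set j]) :
  let a := forall j : 'I_k.+1, center_cluster F Om xbar j !=set0 ->
    global_minimizer
      (fun y : 'rV[R]_d.+1 =>
         \sum_(i in cluster_index F Om xbar j) minimal_time F y (Om i))
      (row j xbar) in
  let b := local_optimal (objective F Om) xbar in
  (a -> b) /\ ((forall i, convex_set (Om i)) -> b -> a).
Proof.
have [c cE] := choice J_singleton.
have [e e0 stable] :=
  assignment_locally_constant F_convex F_int0 Om_neq0 cE.
have self (r : R) : 0 < r -> euclid_ball xbar r xbar.
  move=> r0; rewrite /euclid_ball/= subrr -(scale0r 0) euclid_normZ//.
  by rewrite mul0r.
have objE x : euclid_ball xbar e x -> objective F Om x =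
    \sum_(j < k.+1) \sum_(i < m | c i == j) minimal_time F (row j x) (Om i).
  by move=> /stable xe; exact: objective_partition.
move=> a b; split.
  move=> Ha; exists e => // x xe; rewrite !objE//; last exact: self.
  apply: ler_sum => j _.
  (* For an empty cluster (a) gives nothing, but both inner sums are 0. *)
  have [[i /eqP cij]|no] := pselect (exists i, c i == j); last first.
    by rewrite !big_pred0// => i; apply/negbTE/negP => cij; apply: no; exists i.
  have : center_cluster F Om xbar j !=set0.
    exists (Om i); suff : nearest_centers F Om xbar i j by [].
    by rewrite cE.
  by move=> /Ha/(_ (row j x)); rewrite !(cluster_sumE _ _ cE).
move=> Om_convex [eps eps0 opt] j _ y.
rewrite !(cluster_sumE _ _ cE).
pose S z := \sum_(i < m | c i == j) minimal_time F z (Om i).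
(* Only the center [j] is moved, a fraction [t] of the way towards [y]. *)
rewrite -!/(S _).
pose D : 'M[R]_(k.+1, d.+1) :=
  \matrix_(r < k.+1) (if r == j then y - row j xbar else 0).
pose h := Num.min e eps.
have h0 : 0 < h by rewrite lt_min e0.
have N0 := euclid_norm_ge0 D.
have den0 : 0 < euclid_norm D + h + 1 by lra.
(* keeps xbar + t *: D in both balls, with t <= 1 *)
pose t := h / (euclid_norm D + h + 1).
have t0 : 0 < t by rewrite divr_gt0.
have t1 : t <= 1 by rewrite ler_pdivrMr//; lra.
have tD : t * euclid_norm D < h.
  by rewrite /t mulrAC ltr_pdivrMr// ltr_pM2l//; lra.
pose x := xbar + t *: D.
have near r : h <= r -> euclid_ball xbar r x.
  move=> hr; rewrite /euclid_ball/= addrAC subrr add0r euclid_normZ 1?ltW//.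
  exact: lt_le_trans tD hr.
have xe : euclid_ball xbar e x by apply: near; rewrite ge_min lexx.
have xeps : euclid_ball xbar eps x by apply: near; rewrite ge_min lexx orbT.
have rowx r : row r x =
    if r == j then t *: y + (1 - t) *: row j xbar else row r xbar.
  rewrite raddfD/= linearZ/= rowK; case: eqVneq => [->|_].
    by rewrite scalerBr scalerBl scale1r addrCA addrC.
  by rewrite scaler0 addr0.
have := opt x xeps; rewrite !objE//; last exact: self.
rewrite (bigD1 j)//= [leRHS](bigD1 j)//=.
(* The blocks of the other centers are unchanged and cancel. *)
rewrite [X in _ + X <= _](_ : _ = \sum_(r < k.+1 | r != j)
    \sum_(i < m | c i == r) minimal_time F (row r x) (Om i)); last first.
  by apply: eq_bigr => r /negbTE rj; rewrite rowx rj.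
rewrite lerD2r rowx eqxx -!/(S _) => SSt.
have : S (t *: y + (1 - t) *: row j xbar) <= t * S y + (1 - t) * S (row j xbar).
  rewrite /S !mulr_sumr -big_split/=; apply: ler_sum => i _.
  by apply: minimal_time_convex => //; exact: ltW.
(* Subtracting [(1 - t) * S (row j xbar)] leaves the claim multiplied by [t]. *)
move=> /(le_trans SSt) SS; by rewrite -(ler_pM2l t0); lra.
Qed.
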